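(* For every $n\ge 2$ there exists a simple derivation $D$ of $\Bbbk[x_1,\dots,x_n]$ such that $\dim\operatorname{Aut}(D)^0=n-2$.
   Context: $\Bbbk$ is an algebraically closed field of characteristic $0$. A derivation $D$ of $\Bbbk[x_1,\dots,x_n]$ is a $\Bbbk$-linear endomorphism with $D(fg)=D(f)g+fD(g)$; it is simple if the only ideals $I$ with $D(I)\subset I$ are the trivial ones. $\operatorname{Aut}(D)$ is the group of $\Bbbk$-algebra automorphisms $\varphi$ of $\Bbbk[x_1,\dots,x_n]$ with $\varphi D=D\varphi$. $\operatorname{Aut}(\Bbbk[x_1,\dots,x_n])$ is an ind-group, with filtration $\operatorname{Aut}(\Bbbk[x_1,\dots,x_n])_p=\{\varphi=(f_1,\dots,f_n): \deg f_i\le p\ \forall i\}$, where $f_i=\varphi(x_i)$. $\operatorname{Aut}(D)$ is a closed subgroup, hence an ind-group. $\operatorname{Aut}(D)^0$ is its connected component containing the identity; when $D$ is simple it is an algebraic group. *)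

(* Defs.v *)
From HB Require Import structures.
From mathcomp Require Import all_boot all_order all_algebra.
From mathcomp Require Import mpoly.
From mathcomp Require Import boolp classical_sets topology.

Set Implicit Arguments.
Unset Strict Implicit.
Unset Printing Implicit Defensive.

Import GRing.Theory.

Local Open Scope classical_set_scope.
Local Open Scope ring_scope.

Definition is_derivation (R : comNzRingType) (A : comAlgType R)
    (D : {linear A -> A}) : Prop :=
  forall f g : A, D (f * g) = D f * g + f * D g.

Definition is_ideal (A : comNzRingType) (I : set A) : Prop :=
  [/\ I 0, forall f g, I f -> I g -> I (f + g)
    & forall a f, I f -> I (a * f)].

Definition is_simple (R : comNzRingType) (A : comAlgType R)
    (D : {linear A -> A}) : Prop :=
  forall I : set A, is_ideal I -> D @` I `<=` I ->
    I = [set 0] \/ I = [set: A].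

Record mpoly_aut (n : nat) (k : fieldType) := MPolyAut {
  aut_fun :> {lrmorphism {mpoly k[n]} -> {mpoly k[n]}};
  aut_bij : bijective aut_fun
}.

Section MPolyAut.
Variables (n : nat) (k : fieldType).
Local Notation Aut := (mpoly_aut n k).

Definition aut_id : Aut := @MPolyAut n k idfun (Bijective (frefl _) (frefl _)).

HB.instance Definition _ := gen_eqMixin Aut.
HB.instance Definition _ := gen_choiceMixin Aut.

(* msize f is 1 + deg f, and 0 when f = 0. *)
Definition aut_deg_le (p : nat) : set Aut :=
  [set phi | forall i : 'I_n, (msize (phi 'X_i) <= p.+1)%N].

(* An n-tuple of polynomials of degree at most p is a point of the affine space
   with one coordinate for each pair (i, m), i < n and m a monomial of degree at
   most p: the coefficient of m in the i-th polynomial. *)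
Definition coord_ix (p : nat) := ('I_n * 'X_{1..n < p.+1})%type.

Definition aut_coord (p : nat) (phi : Aut) : 'I_#|{: coord_ix p}| -> k :=
  fun j => (phi 'X_((enum_val j).1))@_((enum_val j).2).

Definition aut_zeros (p : nat) (S : set {mpoly k[#|{: coord_ix p}|]}) :
    set Aut :=
  [set phi | forall P, S P -> P.@[aut_coord phi] = 0].

(* The ind-topology: Z is closed iff its trace on each piece of the filtration
   is Zariski closed in that piece. *)
Definition ind_closed (Z : set Aut) : Prop :=
  forall p, exists S : set {mpoly k[#|{: coord_ix p}|]},
    Z `&` aut_deg_le p = aut_zeros S `&` aut_deg_le p.

Lemma ind_closed0 : ind_closed set0.
Proof.
move=> p; exists setT; rewrite set0I; apply/esym; rewrite -subset0.
by move=> phi [/(_ 1 I)]; rewrite meval1 => /eqP; rewrite oner_eq0.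
Qed.

Lemma ind_closedU (Y Z : set Aut) :
  ind_closed Y -> ind_closed Z -> ind_closed (Y `|` Z).
Proof.
move=> cY cZ p; have [S eS] := cY p; have [T eT] := cZ p.
exists [set P | exists Q R, [/\ S Q, T R & P = Q * R]].
rewrite setIUl eS eT -setIUl; congr (_ `&` _).
apply/seteqP; split=> phi /=.
  by case=> h P [Q [R [SQ TR ->]]]; rewrite mevalM;
    [rewrite (h _ SQ) mul0r | rewrite (h _ TR) mulr0].
move=> h; have [hS|/existsNP[Q /not_implyP[SQ /eqP nQ]]] :=
  pselect (aut_zeros S phi); first by left.
right=> R TR; have /eqP : (Q * R).@[aut_coord phi] = 0.
  by apply: h; exists Q, R.
by rewrite mevalM mulf_eq0 (negbTE nQ) => /eqP.
Qed.

Lemma ind_closed_bigI (I : Type) (Z : I -> set Aut) :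
  (forall i, ind_closed (Z i)) -> ind_closed (\bigcap_i Z i).
Proof.
move=> cZ p; pose S i := projT1 (cid (cZ i p)).
have eS i : Z i `&` aut_deg_le p = aut_zeros (S i) `&` aut_deg_le p.
  exact: (projT2 (cid (cZ i p))).
exists (\bigcup_i S i); apply/seteqP; split=> phi [h dphi]; split=> //.
  move=> P [i _ SP]; have : (Z i `&` aut_deg_le p) phi by split=> //; exact: h.
  by rewrite eS => -[+ _]; exact.
move=> i _; suff : (Z i `&` aut_deg_le p) phi by case.
by rewrite eS; split=> // P SP; apply: h; exists i.
Qed.

Definition ind_open (U : set Aut) : Prop := ind_closed (~` U).

Lemma ind_openT : ind_open setT.
Proof. by rewrite /ind_open setCT; exact: ind_closed0. Qed.

Lemma ind_openI : setI_closed ind_open.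
Proof. by move=> U V oU oV; rewrite /ind_open setCI; exact: ind_closedU. Qed.

Lemma ind_open_bigU (I : Type) (U : I -> set Aut) :
  (forall i, ind_open (U i)) -> ind_open (\bigcup_i U i).
Proof. by move=> oU; rewrite /ind_open setC_bigcup; exact: ind_closed_bigI. Qed.

HB.instance Definition _ :=
  isOpenTopological.Build Aut ind_openT ind_openI ind_open_bigU.

Lemma closedE_ind (Z : set Aut) : closed Z <-> ind_closed Z.
Proof. by rewrite -openC -[in X in _ <-> X](setCK Z). Qed.

Definition Aut_der (D : {linear {mpoly k[n]} -> {mpoly k[n]}}) : set Aut :=
  [set phi | forall f, phi (D f) = D (phi f)].

Definition Aut_der0 (D : {linear {mpoly k[n]} -> {mpoly k[n]}}) : set Aut :=
  connected_component (Aut_der D) aut_id.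

End MPolyAut.

Section KrullDimension.
Variable T : topologicalType.

Definition irreducible_set (A : set T) : Prop :=
  A !=set0 /\ forall F G : set T, closed F -> closed G ->
    A `<=` F `|` G -> A `<=` F \/ A `<=` G.

(* Z 0 `<` ... `<` Z m, irreducible and closed in the subspace A. *)
Definition irreducible_chain (A : set T) (m : nat) (Z : nat -> set T) : Prop :=
  [/\ forall i, (i <= m)%N -> irreducible_set (Z i),
      forall i, (i <= m)%N -> exists2 C, closed C & Z i = A `&` C
    & forall i, (i < m)%N -> Z i `<` Z i.+1].

Definition has_krull_dim (A : set T) (d : nat) : Prop :=
  (exists Z, irreducible_chain A d Z) /\
  (forall m Z, irreducible_chain A m Z -> (m <= d)%N).

End KrullDimension.

(* Main.v *)
Require Import Defs.
From HB Require Import structures.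
From mathcomp Require Import all_boot all_order all_algebra.
From mathcomp Require Import mpoly.
From mathcomp Require Import boolp classical_sets topology.
From mathcomp Require Import ring zify.

(* On k[x, y, z_1, ..., z_m], where m = n - 2, take
     D = d/dx + (x y + 1) d/dy + y d/dz_1 + y^2 d/dz_2 + ... + y^m d/dz_m.
   Simplicity: order the monomials x^a y^b z^c lexicographically by (|c|, b, a).
   If b is the y-exponent of the leading term of f, then D f - b x f is lower
   than f, so that a nonzero D-stable ideal contains some f <> 0 with
   D f = b x f. As d/dz_i commutes with D, and d/dy does so up to x d/dy on
   k[x, y], repeated differentiation reduces such equations to k[x], where a
   degree count leaves only b = 0 and f constant.
   Automorphisms: the same arguments show that an automorphism commuting with D
   fixes x and y, hence moves each z_i by an element of ker D = k. So
   Aut(D) = k^m as a variety.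
   Dimension of k^m: along a chain Z_0 < ... < Z_l of irreducible closed sets,
   choose f_i vanishing on Z_i but not on Z_(i+1). Multiplication by f_i embeds
   the functions on Z_(i+1) into those that vanish on Z_i, so the number of
   independent functions of degree at most t E on Z_i is at least C(t + i, i),
   and C(t + l, l) <= (t E + 1)^m for all t forces l <= m. *)

Local Open Scope ring_scope.

Set Implicit Arguments.
Unset Strict Implicit.
Unset Printing Implicit Defensive.

Import GRing.Theory.

(** * Partial derivatives, and eigenvectors of a simple derivation *)

Section MPolyDerivatives.
Variables (n : nat) (k : fieldType).
Implicit Types (p q : {mpoly k[n]}) (i : 'I_n).

(** Restoring the factor X_i in the leading monomial of the derivative gives a monomial of [p]. The
    inductions on [msize] below rest on this strict decrease. *)
Lemma msize_mderiv_lt i p : p != 0 -> (msize p^`M(i) < msize p)%N.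
Proof.
move=> p0; have [->|d0] := eqVneq (p^`M(i)) 0.
  by rewrite msize0 lt0n msize_poly_eq0.
rewrite -[X in (X < _)%N](mlead_deg d0).
have := mlead_supp d0; rewrite mcoeff_msupp mcoeff_deriv => h.
have /msize_mdeg_lt : (mlead (p^`M(i)) + U_(i))%MM \in msupp p.
  by rewrite mcoeff_msupp; apply: contraNneq h => ->; rewrite mul0rn.
by rewrite mdegD mdeg1 addn1.
Qed.

Lemma msize_mderiv_le i p : (msize p^`M(i) <= msize p)%N.
Proof.
have [->|p0] := eqVneq p 0; first by rewrite mderiv0.
exact/ltnW/msize_mderiv_lt.
Qed.

Lemma pchar0_mulrn_eq0 (c : k) (a : nat) :
  [pchar k] =i pred0 -> (0 < a)%N -> (c *+ a == 0) = (c == 0).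
Proof.
move=> /pcharf0P char0 a0.
by rewrite -mulr_natr mulf_eq0 char0 eqn0Ngt a0 orbF.
Qed.

Lemma mderiv_all0_const p : [pchar k] =i pred0 ->
  (forall i, p^`M(i) = 0) -> p = (p@_0%MM)%:MP.
Proof.
move=> char0 dp; apply/mpolyP => m; rewrite mcoeffC.
have [->|m0] := eqVneq m 0%MM; first by rewrite mulr1.
rewrite mulr0; have [i mi] : exists i, m i != 0%N.
  apply/existsP; rewrite -negb_forall; apply: contraNN m0 => /forallP m0.
  by apply/eqP/mnmP => i; rewrite mnm0E; apply/eqP.
have := congr1 (mcoeff (m - U_(i))%MM) (dp i).
rewrite mcoeff_deriv mcoeff0 submK ?lep1mP // => /eqP.
by rewrite pchar0_mulrn_eq0 // => /eqP.
Qed.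

(* Multiplication by a nonconstant polynomial raises the degree, differentiation
   does not. *)
Lemma mderiv_affine_eq0 i p l u : (1 < msize l)%N -> (msize u <= 1)%N ->
  p^`M(i) = l * p + u -> p = 0.
Proof.
move=> l1 u1 dp; apply/eqP/negPn/negP => p0.
have l0 : l != 0 by rewrite -msize_poly_eq0 -lt0n (ltn_trans _ l1).
have : (msize (l * p) <= msize p)%N.
  have -> : l * p = p^`M(i) - u by rewrite dp addrK.
  apply: leq_trans (msizeD_le _ _) _; rewrite geq_max msizeN msize_mderiv_le.
  by rewrite (leq_trans u1) // lt0n msize_poly_eq0.
rewrite msizeM //; case: (msize l) l1 => [|[|s]] // _.
by rewrite !addSn /= ltnNge leq_addl.
Qed.

Lemma derivationC (D : {linear {mpoly k[n]} -> {mpoly k[n]}}) (c : k) :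
  is_derivation D -> D c%:MP = 0.
Proof.
move=> derD; have D1 : D 1 = 0.
  by have := derD 1 1; rewrite !mulr1 mul1r => /eqP;
     rewrite -subr_eq0 opprD addrA subrr add0r oppr_eq0 => /eqP.
by rewrite -[c%:MP]mulr1 mul_mpolyC linearZ /= D1 scaler0.
Qed.

(* The ideal generated by an eigenvector is stable under D. *)
Lemma simple_eigenvector (D : {linear {mpoly k[n]} -> {mpoly k[n]}}) f l :
  is_derivation D -> is_simple D -> D f = l * f ->
  f = 0 \/ (exists c, f = c%:MP) /\ l = 0.
Proof.
move=> derD simD Df; pose I := [set g | exists h, g = h * f]%classic.
have idI : is_ideal I.
  split; first by exists 0; rewrite mul0r.
    by move=> _ _ [a ->] [b ->]; exists (a + b); rewrite mulrDl.
  by move=> a _ [b ->]; exists (a * b); rewrite mulrA.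
have stI : (D @` I `<=` I)%classic.
  move=> _ [_ [h ->] <-]; exists (D h + h * l).
  by rewrite derD Df mulrDl mulrA.
have If : I f by exists 1; rewrite mul1r.
have [I0|IT] := simD I idI stI; first by left; move: If; rewrite I0.
have [h /esym hf] : I 1 by rewrite IT.
have /andP[/eqP fE _] := mpoly_intro_unit hf.
have [f0|f0] := eqVneq f 0; [by left|right; split; first by exists f@_0%MM].
move: Df; rewrite fE derivationC // -fE => /esym/eqP.
by rewrite mulf_eq0 (negbTE f0) orbF => /eqP.
Qed.

End MPolyDerivatives.

(** * The derivation [der] and its commutators with partial derivatives *)

Section Derivation.
Variables (m : nat) (k : fieldType).
Hypothesis char0 : [pchar k] =i pred0.
Local Notation A := {mpoly k[m.+2]}.
Implicit Types (f q : A) (i : 'I_m) (S T : pred 'X_{1..m.+2}).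

Definition ix : 'I_m.+2 := @Ordinal m.+2 0 isT.
Definition iy : 'I_m.+2 := @Ordinal m.+2 1 isT.
Definition iz i : 'I_m.+2 := rshift 2 i.

Local Notation x := ('X_ix : A).
Local Notation y := ('X_iy : A).
Local Notation z i := ('X_(iz i) : A).

(** Indices start at 0, hence the exponent [i.+1]. These exponents are distinct and positive, so a
    nontrivial combination of the images of the [z i] is never constant; [der_ker] relies on
    this. *)
Definition derf f : A :=
  f^`M(ix) + (x * y + 1) * f^`M(iy) + \sum_(i < m) y ^+ i.+1 * f^`M(iz i).

Lemma derf_is_linear : linear derf.
Proof.
move=> c f g; rewrite /derf !linearP /=.
under eq_bigr do rewrite linearP mulrDr -scalerAr.
rewrite big_split /= -scaler_sumr -!mul_mpolyC.
ring.
Qed.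

HB.instance Definition _ := GRing.isLinear.Build k A A *:%R derf derf_is_linear.

Definition der : {linear A -> A} := derf.

Lemma der_derivation : is_derivation der.
Proof.
move=> f g; rewrite /= /derf !mderivM.
have E i : y ^+ i.+1 * (f * g)^`M(iz i) =
    y ^+ i.+1 * f^`M(iz i) * g + f * (y ^+ i.+1 * g^`M(iz i)).
  by rewrite mderivM; ring.
under eq_bigr do rewrite E; rewrite big_split /= -mulr_sumr -mulr_suml.
ring.
Qed.

Lemma index_cases (j : 'I_m.+2) : [\/ j = ix, j = iy | exists i, j = iz i].
Proof.
case: j => -[|[|j]] lt_j; [constructor 1|constructor 2|constructor 3];
  try exact/val_inj.
by exists (Ordinal (lt_j : (j < m)%N)); apply/val_inj.
Qed.

Lemma ix_neq_iy : (ix == iy) = false. Proof. by []. Qed.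
Lemma ix_neq_iz i : (ix == iz i) = false. Proof. by []. Qed.
Lemma iy_neq_iz i : (iy == iz i) = false. Proof. by []. Qed.

Lemma mderivXU (a b : 'I_m.+2) : ('X_a : A)^`M(b) = (a == b)%:R.
Proof.
rewrite mderivX mnmE; case: eqP => [->|_]; last by rewrite scale0r.
by rewrite -{1}[U_(b)%MM]add0m addmK mpolyX0 scale1r.
Qed.

Lemma der_x : der x = 1.
Proof.
rewrite /= /derf !mderivXU eqxx ix_neq_iy mulr0 addr0 big1 ?addr0 // => i _.
by rewrite mderivXU ix_neq_iz mulr0.
Qed.

Lemma der_y : der y = x * y + 1.
Proof.
rewrite /= /derf !mderivXU eqxx eq_sym ix_neq_iy mulr1 add0r.
by rewrite big1 ?addr0 // => i _; rewrite mderivXU iy_neq_iz mulr0.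
Qed.

Lemma der_z i : der (z i) = y ^+ i.+1.
Proof.
rewrite /= /derf !mderivXU ![iz i == _]eq_sym ix_neq_iz iy_neq_iz mulr0 !add0r.
rewrite (bigD1 i) //= mderivXU eqxx mulr1 big1 ?addr0 // => j ji.
by rewrite mderivXU (inj_eq (@rshift_inj 2 m)) eq_sym (negbTE ji) mulr0.
Qed.

(** The coefficients of [der] do not involve the variables [z i]. *)
Lemma der_mderiv_z i f : (der f)^`M(iz i) = der (f^`M(iz i)).
Proof.
rewrite /= /derf !mderivD mderivM mderivD mderivM !mderivXU ix_neq_iz iy_neq_iz.
rewrite mderivC !(mul0r, mulr0, add0r) ![f^`M(iz i)^`M(_)]mderiv_comm.
congr (_ + _); rewrite linear_sum; apply: eq_bigr => j _ /=.
suff yz e : ('X_iy ^+ e : A)^`M(iz i) = 0.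
  by rewrite mderivM yz mul0r add0r mderiv_comm.
elim: e => [|e IHe]; first by rewrite expr0 mderivC.
by rewrite exprS mderivM mderivXU iy_neq_iz IHe mul0r mulr0 addr0.
Qed.

Lemma der_xy f : (forall i, f^`M(iz i) = 0) ->
  der f = f^`M(ix) + (x * y + 1) * f^`M(iy).
Proof. by move=> f0; rewrite /= /derf big1 ?addr0 // => i _; rewrite f0 mulr0. Qed.

(** The correction term comes from differentiating the coefficient [x * y + 1] in y. *)
Lemma der_mderiv_y f : (forall i, f^`M(iz i) = 0) ->
  der (f^`M(iy)) = (der f)^`M(iy) - x * f^`M(iy).
Proof.
move=> f0; have fy0 i : f^`M(iy)^`M(iz i) = 0 by rewrite mderiv_comm f0 mderiv0.
rewrite !der_xy // !mderivD !mderivM mderivD mderivM !mderivXU eqxx ix_neq_iy.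
rewrite mderivC [f^`M(ix)^`M(iy)]mderiv_comm mulr0n mulr1n; ring.
Qed.

(** * Eigenvectors of [der] and its kernel *)

Lemma msize_cx (c : k) : c != 0 -> (1 < msize (c *: x))%N.
Proof. by move=> c0; rewrite msizeZ // msizeX mdeg1. Qed.

(** The derivatives of [f] in the [z i] satisfy the same equation, so they vanish by induction; the
    derivative in y then satisfies it with [s - 1] in place of [s]. *)
Lemma der_eigen_x f (s : k) : s != 0 -> der f = s *: x * f -> f = 0.
Proof.
have [e] := ubnP (msize f); elim: e f s => // e IHe f s /ltnSE le_e s0 Df.
have [//|f0] := eqVneq f 0.
have IH j t : t != 0 -> der (f^`M(j)) = t *: x * f^`M(j) -> f^`M(j) = 0.
  by move=> t0; apply: IHe => //; apply: leq_trans le_e; exact: msize_mderiv_lt.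
have fz i : f^`M(iz i) = 0.
  apply: (IH _ s) => //; rewrite -der_mderiv_z Df mderivM mderivZ mderivXU.
  by rewrite ix_neq_iz scaler0 mul0r add0r.
have Dy : der (f^`M(iy)) = (s - 1) *: x * f^`M(iy).
  rewrite der_mderiv_y // Df mderivM mderivZ mderivXU ix_neq_iy scaler0.
  by rewrite mul0r add0r scalerBl scale1r mulrBl.
(* For [s = 1] the induction hypothesis does not apply to the derivative in y, which lies in the
   kernel. The second derivative in y has eigenvalue [- x] and vanishes, so the first one is a
   constant [u]. *)
have [s1|s1] := eqVneq s 1; last first.
  have fy : f^`M(iy) = 0 by apply: IH Dy; rewrite subr_eq0.
  apply: (@mderiv_affine_eq0 _ _ ix f (s *: x) 0); rewrite ?msize0 ?msize_cx //.
  by rewrite addr0 -Df der_xy // fy mulr0 addr0.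
move: Dy Df; rewrite {}s1 subrr scale0r scale1r mul0r => Dy Df.
have fyz i : f^`M(iy)^`M(iz i) = 0 by rewrite mderiv_comm fz mderiv0.
have fyy : f^`M(iy)^`M(iy) = 0.
  apply: (IHe _ (-1));
    last by rewrite der_mderiv_y // Dy mderiv0 sub0r scaleN1r mulNr.
    by apply: leq_ltn_trans (msize_mderiv_le _ _) _;
       apply: leq_trans le_e; exact: msize_mderiv_lt.
  by rewrite oppr_eq0 oner_eq0.
have fyx : f^`M(iy)^`M(ix) = 0.
  by have := Dy; rewrite der_xy // fyy mulr0 addr0.
have [u fyE] : exists u, f^`M(iy) = u%:MP.
  eexists; apply: mderiv_all0_const => // j.
  by have [->|->|[i ->]] := index_cases j.
(* The equation for [f] becomes g_x = x g - u for g = f - u y, so g = 0; then f = u y is an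
   eigenvector only if u = 0. *)
have : f - u%:MP * y = 0.
  apply: (@mderiv_affine_eq0 _ _ ix _ x (- u%:MP)).
  - by rewrite msizeX mdeg1.
  - by rewrite msizeN msizeC leq_b1.
  rewrite mderivB mderivM mderivC mderivXU eq_sym ix_neq_iy mul0r mulr0 add0r.
  by move: Df; rewrite der_xy // fyE => /(canRL (addrK _)) ->; ring.
move=> /eqP; rewrite subr_eq0 => /eqP fE.
move: Df; rewrite {1}fE der_derivation derivationC ?der_y; last first.
  exact: der_derivation.
rewrite fE mul0r add0r => /eqP; rewrite -subr_eq0.
have -> : u%:MP * (x * y + 1) - x * (u%:MP * y) = u%:MP :> A by ring.
by rewrite mpolyC_eq0 => /eqP ->; rewrite mpolyC0 mul0r.
Qed.

(* Differentiating in y turns the equation into the same one with s + 1 in place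
   of s, and lowers P until it is a constant. *)
Lemma der_neq_poly_y (P q : A) (s : nat) :
    (forall i, q^`M(iz i) = 0) -> (forall i, P^`M(iz i) = 0) ->
    P^`M(ix) = 0 -> P != 0 -> (0 < s)%N || (P^`M(iy) != 0) ->
  der q != P - s%:R *: x * q.
Proof.
have [e] := ubnP (msize P); elim: e P q s => // e IHe P q s /ltnSE le_e.
move=> qz Pz Px P0 sP; apply/eqP => Dq.
have qyz i : q^`M(iy)^`M(iz i) = 0 by rewrite mderiv_comm qz mderiv0.
have Dqy : der q^`M(iy) = P^`M(iy) - s.+1%:R *: x * q^`M(iy).
  rewrite der_mderiv_y // Dq mderivB mderivM mderivZ mderivXU ix_neq_iy.
  by rewrite mulr0n scaler0 -natr1 scalerDl scale1r; ring.
have [Py|Py] := eqVneq P^`M(iy) 0; last first.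
  suff : der q^`M(iy) != P^`M(iy) - s.+1%:R *: x * q^`M(iy) by rewrite Dqy eqxx.
  apply: IHe => //.
  - by apply: leq_trans le_e; exact: msize_mderiv_lt.
  - by move=> i; rewrite mderiv_comm Pz mderiv0.
  - by rewrite mderiv_comm Px mderiv0.
have PE : P = (P@_0%MM)%:MP.
  by apply: mderiv_all0_const => // j; have [->|->|[i ->]] := index_cases j.
(* Once [P] is constant, [s] is positive: the derivative of [q] in y has the nonzero eigenvalue -(s
   + 1) x, and [q] itself satisfies q_x = - s x q + P. *)
move: sP; rewrite Py eqxx orbF => s0.
have sk t : (0 < t)%N -> - t%:R != 0 :> k.
  by rewrite oppr_eq0 => t0; rewrite pchar0_mulrn_eq0 ?oner_eq0.
have qy : q^`M(iy) = 0.
  apply: (@der_eigen_x _ (- s.+1%:R)); first exact: sk.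
  by rewrite Dqy Py sub0r scaleNr mulNr.
have q0 : q = 0.
  apply: (@mderiv_affine_eq0 _ _ ix _ (- s%:R *: x) P).
  - exact/msize_cx/sk.
  - by rewrite PE msizeC leq_b1.
  by move: Dq; rewrite der_xy // qy mulr0 addr0 => ->; rewrite addrC scaleNr mulNr.
by move: Dq P0; rewrite q0 linear0 mulr0 subr0 => <-; rewrite eqxx.
Qed.

(** By induction the derivatives in the [z i] are constants [c i]. Removing the linear part in z
    leaves some [q] in x and y whose image under [der] is a polynomial in y, which [der_neq_poly_y]
    excludes unless all [c i] vanish. *)
Lemma der_ker f : der f = 0 -> exists c, f = c%:MP.
Proof.
have [e] := ubnP (msize f); elim: e f => // e IHe f /ltnSE le_e Df.
have [->|f0] := eqVneq f 0; first by exists 0; rewrite mpolyC0.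
have /fin_all_exists[c fz] i : exists c, f^`M(iz i) = c%:MP.
  apply: IHe; last by rewrite -der_mderiv_z Df mderiv0.
  by apply: leq_trans le_e; exact: msize_mderiv_lt.
pose q := f - \sum_(i < m) c i *: z i.
have qz i : q^`M(iz i) = 0.
  have E j : (c j *: z j)^`M(iz i) = (if j == i then c i else 0)%:MP.
    rewrite mderivZ mderivXU (inj_eq (@rshift_inj 2 m)).
    by case: eqP => [->|_];
      rewrite ?mulr0n ?scaler0 ?mulr1n ?mpolyC0 // alg_mpolyC.
  rewrite mderivB fz (linear_sum (mderiv (iz i))) /=.
  under eq_bigr do rewrite E.
  rewrite (bigD1 i) //= eqxx big1 ?addr0 ?subrr // => j /negbTE ->.
  exact: mpolyC0.
pose P := - \sum_(i < m) c i *: y ^+ i.+1.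
have Dq : der q = P.
  rewrite linearB Df sub0r; congr (- _); rewrite (linear_sum der).
  by apply: eq_bigr => i _; rewrite linearZ der_z.
have Pd j : j != iy -> P^`M(j) = 0.
  move=> jy; have yj e' : (y ^+ e')^`M(j) = 0.
    elim: e' => [|a IHa]; first by rewrite mderivC.
    rewrite exprS mderivM mderivXU eq_sym (negbTE jy) IHa.
    by rewrite mulr0n mul0r mulr0 addr0.
  rewrite mderivN (linear_sum (mderiv j)) big1 ?oppr0 // => i _ /=.
  by rewrite mderivZ yj scaler0.
have Pc i : P@_(U_(iy) *+ i.+1) = - c i.
  have E j : (c j *: y ^+ j.+1)@_(U_(iy) *+ i.+1) = if j == i then c i else 0.
    rewrite mcoeffZ mcoeffXn.
    have [->|ji] := eqVneq j i; first by rewrite eqxx mulr1.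
    case: eqP => [/mnmP/(_ iy)|]; last by rewrite mulr0.
    rewrite !mulmnE mnm1E eqxx !mul1n => -[/val_inj ij].
    by rewrite ij eqxx in ji.
  rewrite mcoeffN (raddf_sum (mcoeff _)) /=; under eq_bigr do rewrite E.
  by rewrite (bigD1 i) //= eqxx big1 ?addr0 // => j /negbTE ->.
have c0 i : c i = 0.
  apply/eqP/negPn/negP => ci.
  (* This nonconstancy is what allows [s = 0] in [der_neq_poly_y]. *)
  have Py : P^`M(iy) != 0.
    apply: contraNneq ci => /(congr1 (mcoeff (U_(iy) *+ i))) /eqP.
    rewrite mcoeff_deriv mcoeff0 pchar0_mulrn_eq0 // -mulmSr Pc oppr_eq0.
    by [].
  suff : der q != P - 0%:R *: x * q by rewrite Dq scale0r mul0r subr0 eqxx.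
  apply: der_neq_poly_y => // [j||]; [exact: Pd|exact: Pd|].
  by apply: contraNneq Py => ->; rewrite mderiv0.
have fz0 i : f^`M(iz i) = 0 by rewrite fz c0 mpolyC0.
have fy : f^`M(iy) = 0.
  apply: (@der_eigen_x _ (-1)); first by rewrite oppr_eq0 oner_eq0.
  by rewrite der_mderiv_y // Df mderiv0 sub0r scaleN1r mulNr.
eexists; apply: mderiv_all0_const => // j.
have [->|->|[i ->]] // := index_cases j.
by have := Df; rewrite der_xy // fy mulr0 addr0.
Qed.

(** * Descent along the lexicographic order, and simplicity *)

Definition zdeg (a : 'X_{1..m.+2}) : nat := \sum_(i < m) a (iz i).

Lemma zdegD a b : zdeg (a + b) = (zdeg a + zdeg b)%N.
Proof. by rewrite /zdeg -big_split; apply: eq_bigr => i _; rewrite mnmDE. Qed.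

Lemma zdeg_x : zdeg U_(ix) = 0%N.
Proof. by apply: big1 => i _; rewrite mnm1E ix_neq_iz. Qed.

Lemma zdeg_yn e : zdeg (U_(iy) *+ e) = 0%N.
Proof. by apply: big1 => i _; rewrite mulmnE mnm1E iy_neq_iz. Qed.

Lemma zdeg_z i : zdeg U_(iz i) = 1%N.
Proof.
rewrite /zdeg (bigD1 i) //= mnm1E eqxx big1 // => j ji.
by rewrite mnm1E (inj_eq (@rshift_inj 2 m)) eq_sym (negbTE ji).
Qed.

Lemma zdeg_le a : (zdeg a <= mdeg a)%N.
Proof.
have -> : mdeg a = (\sum_(i < 2 + m) a i)%N := mdegE a.
by rewrite big_split_ord leq_addl.
Qed.

Lemma mnm_le_mdeg (a : 'X_{1..m.+2}) j : (a j <= mdeg a)%N.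
Proof. by rewrite mdegE (bigD1 j) //= leq_addr. Qed.

Definition lex_lt (d b e : nat) (a : 'X_{1..m.+2}) : bool :=
  (zdeg a < d)%N ||
  (zdeg a == d) && ((a iy < b)%N || (a iy == b) && (a ix < e)%N).

Definition supp_in (S : pred 'X_{1..m.+2}) f : Prop :=
  {in msupp f, forall a, S a}.

Lemma supp_in0 S : supp_in S 0.
Proof. by move=> a; rewrite msupp0. Qed.

Lemma supp_inD S f q : supp_in S f -> supp_in S q -> supp_in S (f + q).
Proof.
by move=> Sf Sq a /msuppD_le; rewrite mem_cat => /orP[/Sf|/Sq].
Qed.

Lemma supp_in_sum S (I : Type) (r : seq I) (P : pred I) (F : I -> A) :
  (forall j, P j -> supp_in S (F j)) -> supp_in S (\sum_(j <- r | P j) F j).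
Proof.
by move=> SF; apply: big_ind => //; [exact: supp_in0|exact: supp_inD].
Qed.

Lemma supp_inZX S (c : k) a : (c != 0 -> S a) -> supp_in S (c *: 'X_[a]).
Proof.
move=> Sa b; rewrite mcoeff_msupp mcoeffZ mcoeffX => cb.
have [ab|ab] := eqVneq a b; last by rewrite (negbTE ab) mulr0 eqxx in cb.
by rewrite -ab Sa //; apply: contraNneq cb => ->; rewrite mul0r.
Qed.

Lemma supp_inW S T f : supp_in S f -> (forall a, a \in msupp f -> S a -> T a) ->
  supp_in T f.
Proof. by move=> Sf ST a af; apply: ST => //; exact: Sf. Qed.

(** Subtraction of monomials is truncated; where the coefficient produced by differentiation is
    nonzero, it is a true difference. *)
Lemma mnm_natr_neq0 (a : 'X_{1..m.+2}) j :
  (a j)%:R != 0 :> k -> (U_(j) <= a)%MM.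
Proof. by rewrite lep1mP; apply: contraNN => /eqP ->. Qed.

(** The part x y d/dy multiplies the monomial by [a iy] times x, which merges with the subtracted
    [c *: x]. *)
Lemma der_monomial a (c : k) :
  der 'X_[a] - c *: x * 'X_[a] =
  (a ix)%:R *: 'X_[a - U_(ix)] + ((a iy)%:R - c) *: 'X_[a + U_(ix)]
  + (a iy)%:R *: 'X_[a - U_(iy)]
  + \sum_(i < m) (a (iz i))%:R *: 'X_[a - U_(iz i) + U_(iy) *+ i.+1].
Proof.
have yE : (a iy)%:R *: (x * y * 'X_[a - U_(iy)]) =
    (a iy)%:R *: (x * 'X_[a]) :> A.
  have [->|ay] := eqVneq (a iy) 0%N; first by rewrite !scale0r.
  by rewrite -mulrA -mpolyXD addmC submK // lep1mP.
have E i : y ^+ i.+1 * 'X_[a]^`M(iz i) =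
    (a (iz i))%:R *: 'X_[a - U_(iz i) + U_(iy) *+ i.+1] :> A.
  by rewrite mderivX -scalerAr mpolyXn -mpolyXD addmC.
rewrite /= /derf (eq_bigr _ (fun i _ => E i)) !mderivX.
rewrite mulrDl mul1r -scalerAr yE mpolyXD -!mul_mpolyC mpolyCB.
ring.
Qed.

(** Of the four kinds of terms in [der_monomial], three lower the exponent of x, the exponent of y
    or the z-degree. The remaining one raises the exponent of x, but its coefficient vanishes when
    the exponent of y is [b]. *)
Lemma der_lex_lt d b e f : supp_in (lex_lt d b e.+1) f ->
  supp_in (lex_lt d b e) (der f - b%:R *: x * f).
Proof.
move=> Sf.
have -> : der f - b%:R *: x * f =
    \sum_(a <- msupp f) f@_a *: (der 'X_[a] - b%:R *: x * 'X_[a]).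
  rewrite {1 2}[f]mpolyE linear_sum mulr_sumr -sumrB; apply: eq_bigr => a _.
  by rewrite linearZ scalerBr scalerAr.
rewrite big_seq; apply: supp_in_sum => a /Sf lt_a.
rewrite der_monomial !scalerDr !scalerA scaler_sumr.
have nz (c t : k) : c * t != 0 -> t != 0.
  by apply: contraNneq => ->; rewrite mulr0.
do ![apply: supp_inD]; last apply: supp_in_sum => i _; rewrite ?scalerA.
- apply: supp_inZX => /nz /mnm_natr_neq0 /submK aE.
  move: lt_a; rewrite -{1}aE /lex_lt zdegD zdeg_x addn0 !mnmDE !mnm1E eqxx.
  by rewrite eq_sym ix_neq_iy addn0 addn1 ltnS.
- apply: supp_inZX => /nz; rewrite subr_eq0 => ab.
  have {}ab : a iy != b by apply: contraNneq ab => ->.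
  move: lt_a; rewrite /lex_lt zdegD zdeg_x addn0 !mnmDE !mnm1E ix_neq_iy addn0.
  by rewrite (negbTE ab) !orbF.
- apply: supp_inZX => /nz /mnm_natr_neq0 /submK aE.
  move: lt_a; rewrite -{1}aE /lex_lt zdegD (zdeg_yn 1) addn0 !mnmDE !mnm1E eqxx.
  rewrite addn1 => /orP[->//|/andP[-> /= h]]; apply/orP; right; apply/orP; left.
  by case/orP: h => [/ltnW|/andP[/eqP <-]].
- apply: supp_inZX => /nz /mnm_natr_neq0 /submK aE.
  move: lt_a; rewrite -{1}aE /lex_lt !zdegD zdeg_z zdeg_yn addn0 addn1.
  by case/orP => [/ltnW ->//|/andP[/eqP <-]]; rewrite ltnSn.
Qed.

(** Transfinite descent along the lexicographic order, written as nested inductions on [d], [b] and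
    [e]: [step_x] is the successor step, [step_y] and [step_z] are the limit steps. *)
Lemma ideal_eigen_x (I : set A) : is_ideal I -> (der @` I `<=` I)%classic ->
  forall f, I f -> f != 0 ->
  exists2 g, I g /\ g != 0 & exists b : nat, der g = b%:R *: x * g.
Proof.
move=> [I0 ID IM] stI.
pose concl := exists2 g, I g /\ g != 0 & exists b : nat, der g = b%:R *: x * g.
pose P d b e := forall f, I f -> f != 0 -> supp_in (lex_lt d b e) f -> concl.
have step_x d b e : P d b e -> P d b e.+1.
  move=> IH f If f0 /der_lex_lt Sf.
  have [Df|Df] := eqVneq (der f - b%:R *: x * f) 0.
    by exists f => //; exists b; apply/eqP; rewrite -subr_eq0 Df.
  apply: IH Df Sf; apply: ID; first by apply: stI; exists f.
  by rewrite -mulNr; apply: IM.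
(* At a limit, [msize f] exceeds every exponent in [f], so it serves as the bound on the next
   exponent. *)
have step_y d b : (forall e, P d b e) -> P d b.+1 0%N.
  move=> IH f If f0 Sf; apply: (IH (msize f) f If f0).
  apply: supp_inW Sf _ => a /msize_mdeg_lt a_lt.
  rewrite /lex_lt !andbF orbF ltnS [(a iy <= b)%N]leq_eqVlt.
  have -> : (a ix < msize f)%N by apply: leq_ltn_trans a_lt; exact: mnm_le_mdeg.
  by rewrite andbT [(a iy == b) || _]orbC.
have step_z d : (forall b e, P d b e) -> P d.+1 0%N 0%N.
  move=> IH f If f0 Sf; apply: (IH (msize f) 0%N f If f0).
  apply: supp_inW Sf _ => a /msize_mdeg_lt a_lt.
  rewrite /lex_lt !andbF orbF ltnS leq_eqVlt.
  have -> : (a iy < msize f)%N by apply: leq_ltn_trans a_lt; exact: mnm_le_mdeg.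
  by rewrite andbT orbC.
have P0 : P 0%N 0%N 0%N.
  move=> f _ f0 Sf; case/negP: f0; rewrite -msupp_eq0.
  move: Sf; rewrite /supp_in; case: (msupp f) => // a s /(_ a (mem_head _ _)).
  by rewrite /lex_lt !andbF.
have Pall d b e : P d b e.
  elim: d b e => [|d IHd] b e.
    elim: b e => [|b IHb]; elim=> [//|e]; [exact: step_x| |exact: step_x].
    exact: step_y.
  elim: b e => [|b IHb]; elim=> [|e]; [|exact: step_x| |exact: step_x].
    exact: step_z.
  exact: step_y.
move=> f If f0; apply: (Pall (msize f) 0%N 0%N f If f0) => a af.
by rewrite /lex_lt (leq_ltn_trans (zdeg_le a)) // msize_mdeg_lt.
Qed.

Lemma der_simple : is_simple der.
Proof.
move=> I idI stI; have [If|] := pselect (forall f, I f -> f = 0).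
  left; apply/seteqP; split=> [f /If|_ ->] //; by case: idI.
move=> /existsNP[f /not_implyP[If /eqP f0]]; right.
have [g [Ig g0] [b Dg]] := ideal_eigen_x idI stI If f0.
have [b0|b0] := eqVneq (b%:R : k) 0; last first.
  by rewrite (der_eigen_x b0 Dg) eqxx in g0.
have [c gc] : exists c, g = c%:MP.
  by apply: der_ker; rewrite Dg b0 scale0r mul0r.
have c0 : c != 0 by rewrite -(mpolyC_eq0 m.+2) -gc.
apply/seteqP; split=> // h _; case: idI => _ _ /(_ (h * c^-1%:MP) g Ig).
by rewrite gc -mulrA -mpolyCM mulVf // mpolyC1 mulr1.
Qed.

End Derivation.

(** * Translations as automorphisms of the polynomial ring *)

Section Translations.
Variables (n : nat) (k : fieldType).
Implicit Types (p : {mpoly k[n]}) (w : 'I_n -> k).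

Lemma mpoly_gen_ind (P : {mpoly k[n]} -> Prop) :
    (forall c, P c%:MP) -> (forall i, P 'X_i) ->
    (forall p q, P p -> P q -> P (p + q)) ->
    (forall p q, P p -> P q -> P (p * q)) ->
  forall p, P p.
Proof.
move=> PC PX PD PM; have P1 : P 1 by rewrite -mpolyC1.
have PXn i e : P ('X_i ^+ e) by elim: e => // e IHe; rewrite exprS; exact: PM.
apply: mpolyind => [|c a p _ _ Pp].
  by rewrite -(mpolyC0 n).
apply: PD (Pp); rewrite -mul_mpolyC; apply: (PM); first exact: PC.
rewrite mpolyXE_id; apply: (big_ind P) => [||i _].
- exact: P1.
- exact: PM.
- exact: PXn.
Qed.

Definition translation_fun w : {mpoly k[n]} -> {mpoly k[n]} :=
  comp_mpoly [tuple 'X_i + (w i)%:MP | i < n].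

HB.instance Definition _ w := GRing.LRMorphism.on (translation_fun w).

Lemma translation_funX w i : translation_fun w 'X_i = 'X_i + (w i)%:MP.
Proof. by rewrite /translation_fun comp_mpolyXU -tnth_nth tnth_mktuple. Qed.

Lemma translation_funC w c : translation_fun w c%:MP = c%:MP.
Proof. exact: comp_mpolyC. Qed.

Lemma translation_funK w w' : (forall i, w i + w' i = 0) ->
  cancel (translation_fun w) (translation_fun w').
Proof.
move=> ww'; elim/mpoly_gen_ind => [c|i|p q IHp IHq|p q IHp IHq].
- by rewrite !translation_funC.
- rewrite translation_funX rmorphD /= translation_funX translation_funC.
  by rewrite -addrA -mpolyCD addrC -[w' i + _]addrC ww' mpolyC0 add0r.
- by rewrite !rmorphD /= IHp IHq.
- by rewrite !rmorphM /= IHp IHq.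
Qed.

Lemma translation_bij w : bijective (translation_fun w).
Proof.
by exists (translation_fun (fun i => - w i)); apply: translation_funK => i;
  rewrite ?subrr // addrC subrr.
Qed.

Definition translation w : mpoly_aut n k :=
  @MPolyAut n k (translation_fun w) (translation_bij w).

End Translations.

(** * The automorphisms that commute with [der] *)

Section AutDer.
Variables (m : nat) (k : fieldType).
Hypothesis char0 : [pchar k] =i pred0.
Local Notation A := {mpoly k[m.+2]}.
Local Notation der := (@der m k).
Local Notation ix := (@ix m).
Local Notation iy := (@iy m).
Local Notation x := ('X_ix : A).
Local Notation y := ('X_iy : A).
Local Notation z i := ('X_(iz i) : A).

Lemma derC c : der c%:MP = 0.
Proof. exact/derivationC/der_derivation. Qed.

Section Element.
Variable phi : mpoly_aut m.+2 k.
Hypothesis phiD : Aut_der der phi.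

Lemma aut_der_const f q : der f = der q -> exists c, f = q + c%:MP.
Proof.
move=> fq; have [|c /eqP] := @der_ker m k char0 (f - q).
  by rewrite linearB fq subrr.
by rewrite subr_eq addrC => /eqP ->; exists c.
Qed.

(** From D(phi x) = 1 follows phi x = x + c, and h = phi y satisfies D h = (x + c) h + 1. Simplicity
    kills the derivatives of h in the [z i], after which D h_y = c h_y. If c is nonzero, then h_y =
    0 and a degree count in x gives h = 0, which is absurd; if c = 0, then h - y is an eigenvector
    for x, hence 0. *)
Lemma aut_der_xy : phi x = x /\ phi y = y.
Proof.
have [c xE] : exists c, phi x = x + c%:MP.
  by apply: aut_der_const; rewrite -phiD !der_x rmorph1.
have Dy : der (phi y) = (x + c%:MP) * phi y + 1.
  by rewrite -phiD der_y rmorphD rmorphM rmorph1 /= xE.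
have xcx : (x + c%:MP)^`M(ix) = 1.
  by rewrite mderivD mderivC mderivXU eqxx addr0.
have xcj j : ix != j -> (x + c%:MP)^`M(j) = 0.
  by move=> /negbTE xj; rewrite mderivD mderivC mderivXU xj addr0.
have yz i : (phi y)^`M(iz i) = 0.
  have := @simple_eigenvector _ _ _ ((phi y)^`M(iz i)) (x + c%:MP)
    (@der_derivation m k) (der_simple char0).
  rewrite -der_mderiv_z Dy !mderivD mderivM xcj // mderivC mul0r add0r addr0.
  case=> // -[_ /(congr1 (mderiv ix)) /eqP].
  by rewrite xcx mderiv0 oner_eq0.
have yy : der ((phi y)^`M(iy)) = c%:MP * (phi y)^`M(iy).
  rewrite der_mderiv_y // Dy mderivD mderivM xcj // mderivC.
  ring.
have [c0|c0] := eqVneq c 0.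
  split; first by rewrite xE c0 mpolyC0 addr0.
  apply/eqP; rewrite -subr_eq0; apply/eqP.
  apply: (@der_eigen_x _ _ char0 _ 1); first exact: oner_neq0.
  by rewrite linearB Dy c0 mpolyC0 der_y scale1r; ring.
have [yy0|[_ /eqP]] :=
  simple_eigenvector (@der_derivation m k) (der_simple char0) yy;
  last by rewrite mpolyC_eq0 (negbTE c0).
suff y0 : phi y = 0.
  by move: Dy; rewrite y0 linear0 mulr0 add0r => /esym/eqP; rewrite oner_eq0.
apply: (@mderiv_affine_eq0 _ _ ix _ (x + c%:MP) 1); last 1 first.
- by rewrite -Dy der_xy // yy0 mulr0 addr0.
- rewrite ltnNge; apply: contraTN isT => /msize1_polyC xcE.
  by move: xcx; rewrite xcE mderivC => /esym/eqP; rewrite oner_eq0.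
- by rewrite msize1.
Qed.

(** Reading off a constant term makes sense on the whole automorphism group and is one of its
    coordinates; on [Aut_der der] it is the translation vector. *)
Definition aut_offset (psi : mpoly_aut m.+2 k) (i : 'I_m) : k :=
  (psi (z i))@_0%MM.

Lemma aut_der_z i : phi (z i) = z i + (aut_offset phi i)%:MP.
Proof.
have [c zE] : exists c, phi (z i) = z i + c%:MP.
  by apply: aut_der_const; rewrite -phiD !der_z rmorphXn /= aut_der_xy.2.
rewrite /aut_offset zE mcoeffD mcoeffC mcoeffX eqxx mulr1.
suff -> : (U_(iz i) == 0)%MM = false :> bool by rewrite add0r.
by apply/eqP => /mnmP/(_ (iz i)); rewrite mnm1E eqxx mnm0E.
Qed.

End Element.

(** Extension by zero to x and y. The values lie in [k] for an actual translation, and in a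
    polynomial ring for the generic one. *)
Definition along_z (R : zmodType) (v : 'I_m -> R) (j : 'I_m.+2) : R :=
  if split (j : 'I_(2 + m)) is inr i then v i else 0.

Lemma along_z_xy (R : zmodType) (v : 'I_m -> R) :
  along_z v ix = 0 /\ along_z v iy = 0.
Proof.
have xE : ix = unsplit (inl ord0 : 'I_2 + 'I_m) by exact/val_inj.
have yE : iy = unsplit (inl ord_max : 'I_2 + 'I_m) by exact/val_inj.
by rewrite /along_z xE yE !unsplitK.
Qed.

Lemma along_z_z (R : zmodType) (v : 'I_m -> R) i : along_z v (iz i) = v i.
Proof. by rewrite /along_z -[iz i]/(unsplit (inr i)) unsplitK. Qed.

Lemma aut_derX phi j : Aut_der der phi ->
  phi 'X_j = 'X_j + (along_z (aut_offset phi) j)%:MP.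
Proof.
move=> phiD; have [->|->|[i ->]] := index_cases j.
- by rewrite (aut_der_xy phiD).1 (along_z_xy _).1 mpolyC0 addr0.
- by rewrite (aut_der_xy phiD).2 (along_z_xy _).2 mpolyC0 addr0.
- by rewrite along_z_z aut_der_z.
Qed.

Lemma translation_Aut_der v : Aut_der der (translation (along_z v)).
Proof.
set t := translation _; have tX j : t 'X_j = 'X_j + (along_z v j)%:MP.
  exact: translation_funX.
have tC c : t c%:MP = c%:MP by exact: translation_funC.
have tD p q : t (p + q) = t p + t q by exact: rmorphD.
have tM p q : t (p * q) = t p * t q by exact: rmorphM.
have dD p q : der (p + q) = der p + der q by exact: linearD.
have dM p q : der (p * q) = der p * q + p * der q by exact: der_derivation.
elim/mpoly_gen_ind => [c|j|p q IHp IHq|p q IHp IHq].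
- by rewrite tC !derC rmorph0.
- rewrite tX (linearD der) derC addr0.
  have tx : t x = x by rewrite tX (along_z_xy _).1 mpolyC0 addr0.
  have ty : t y = y by rewrite tX (along_z_xy _).2 mpolyC0 addr0.
  have [->|->|[i ->]] := index_cases j.
  + by rewrite der_x rmorph1.
  + by rewrite der_y rmorphD rmorphM rmorph1 /= tx ty.
  + by rewrite der_z rmorphXn /= ty.
- by rewrite dD (tD (der p)) (tD p) dD IHp IHq.
- by rewrite dM tD (tM (der p)) (tM p (der q)) (tM p q) dM IHp IHq.
Qed.

Lemma aut_offset_translation v : aut_offset (translation (along_z v)) =1 v.
Proof.
move=> i; rewrite /aut_offset /= translation_funX along_z_z.
rewrite mcoeffD mcoeffC mcoeffX eqxx mulr1.
suff -> : (U_(iz i) == 0)%MM = false :> bool by rewrite add0r.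
by apply/eqP => /mnmP/(_ (iz i)); rewrite mnm1E eqxx mnm0E.
Qed.

End AutDer.

(** * Growth of binomial coefficients against powers *)

Lemma expn_le_ffact t l : (t.+1 ^ l <= (t + l) ^_ l)%N.
Proof.
elim: l => [|l IHl]; first by rewrite ffactn0.
by rewrite addnS ffactSS expnS leq_mul // ltnS leq_addr.
Qed.

Lemma bin_le_expn l m E :
  (forall t, 'C(t + l, l) <= (t * E).+1 ^ m)%N -> (l <= m)%N.
Proof.
move=> binE; rewrite leqNgt; apply/negP => ml.
(* If m < l, this [t] absorbs all constants: (t + 1)^(m + 1) is at most l! C(t + l, l), hence at
   most l! (E + 1)^m (t + 1)^m = t (t + 1)^m. *)
pose t := (l`! * E.+1 ^ m)%N.
have : (t.+1 ^ m.+1 <= t * t.+1 ^ m)%N.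
  apply: leq_trans (leq_trans (expn_le_ffact t l) _).
    by rewrite leq_pexp2l.
  rewrite -bin_ffact mulnC /t -mulnA leq_mul2l -/t -expnMn orbC.
  apply/orP; left; apply: leq_trans (binE t) _; case: (m) => // m'.
  by rewrite leq_exp2r // !(mulSn, mulnS); lia.
by rewrite expnS leq_pmul2r ?ltnn // expn_gt0.
Qed.

(** * Krull dimension of affine space *)

Section AffineDimension.
Variables (k : closedFieldType) (m : nat) (T : topologicalType).
Variables (A : set T) (c : T -> 'I_m -> k).

Local Open Scope classical_set_scope.

(* c identifies A, with the topology induced by T, with the affine space k^m. *)
Hypothesis closed_zeros : forall P : {mpoly k[m]},
  closed [set t | P.@[c t] = 0].
Hypothesis closed_traceE : forall C, closed C ->
  exists S : set {mpoly k[m]},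
    forall t, A t -> C t <-> forall P, S P -> P.@[c t] = 0.
Hypothesis c_onto : forall v, exists2 t, A t & c t =1 v.

Definition coord_subspace (i : nat) : set T :=
  [set t | A t /\ forall j : 'I_m, (i <= j)%N -> c t j = 0].

(** The pullback of [P] along the line that is at [u] for parameter 0 and at [v] for parameter 1. *)
Definition line_poly (u v : 'I_m -> k) (P : {mpoly k[m]}) : {poly k} :=
  mmap polyC (fun j => (u j)%:P + (v j - u j)%:P * 'X) P.

Lemma horner_line_poly u v P s :
  (line_poly u v P).[s] = P.@[fun j => u j + (v j - u j) * s].
Proof.
rewrite /line_poly /mmap mevalE horner_sum; apply: eq_bigr => a _.
rewrite hornerM hornerC; congr (_ * _); rewrite horner_prod.
apply: eq_bigr => j _.
by rewrite horner_exp !hornerE.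
Qed.

(* Two polynomials that do not vanish at u and v respectively restrict to
   nonzero polynomials on the line through u and v. *)
Lemma coord_subspace_irreducible i : irreducible_set (coord_subspace i).
Proof.
split.
  by have [t At ct] := c_onto (fun=> 0); exists t; split=> // j _; rewrite ct.
move=> F G clF clG FG.
have [|/existsNP[t /not_implyP[tE tF]]] :=
  pselect (coord_subspace i `<=` F); first by left.
have [|/existsNP[t' /not_implyP[t'E t'G]]] :=
  pselect (coord_subspace i `<=` G); first by right.
have [S SE] := closed_traceE clF; have [S' S'E] := closed_traceE clG.
have /existsNP[P /not_implyP[SP /eqP Pt]] : ~ forall P, S P -> P.@[c t] = 0.
  by move/(SE t tE.1).
have /existsNP[Q /not_implyP[SQ /eqP Qt]] : ~ forall P, S' P -> P.@[c t'] = 0.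
  by move/(S'E t' t'E.1).
pose p := line_poly (c t) (c t') P; pose q := line_poly (c t) (c t') Q.
have p0 : p != 0.
  apply: contraNneq Pt => p0; have := horner_line_poly (c t) (c t') P 0.
  rewrite -/p p0 horner0 => ->; apply/eqP/meval_eq => j.
  by rewrite mulr0 addr0.
have q0 : q != 0.
  apply: contraNneq Qt => q0; have := horner_line_poly (c t) (c t') Q 1.
  rewrite -/q q0 horner0 => ->; apply/eqP/meval_eq => j.
  by rewrite mulr1 addrC subrK.
(* An algebraically closed field is infinite, so some parameter [s] is a root of neither factor. *)
have /closed_nonrootP[s] : p * q != 0 by rewrite mulf_neq0.
rewrite rootM negb_or !rootE !horner_line_poly => /andP[Ps Qs].
have [r Ar cr] := c_onto (fun j => c t j + (c t' j - c t j) * s).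
have /FG[/(SE r Ar)/(_ P SP)|/(S'E r Ar)/(_ Q SQ)] : coord_subspace i r.
- split=> // j ij; rewrite cr (tE.2 _ ij) (t'E.2 _ ij).
  by rewrite subrr mul0r addr0.
- by rewrite (meval_eq _ cr) => /eqP; rewrite (negbTE Ps).
- by rewrite (meval_eq _ cr) => /eqP; rewrite (negbTE Qs).
Qed.

Lemma coord_subspaceT : coord_subspace m = A.
Proof.
apply/seteqP; split=> [t []//|t At]; split=> // j.
by rewrite leqNgt ltn_ord.
Qed.

Lemma affine_irreducible : irreducible_set A.
Proof. by rewrite -coord_subspaceT; exact: coord_subspace_irreducible. Qed.

Lemma coord_subspace_chain : irreducible_chain A m coord_subspace.
Proof.
split=> [i _|i _|i im]; first exact: coord_subspace_irreducible.
  exists (\bigcap_(j in [set j : 'I_m | (i <= j)%N])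
            [set t | ('X_j : {mpoly k[m]}).@[c t] = 0]).
    by apply: closed_bigI => j _; exact: closed_zeros.
  by apply/seteqP; split=> t [At ct]; split=> // j ij;
    [rewrite /= mevalXU; exact: ct|rewrite -mevalXU; exact: ct].
split=> [|sub].
  by move=> t [At ct]; split=> // j /ltnW; exact: ct.
(* The basis vector number [i] separates consecutive subspaces. *)
have [t At ct] := c_onto (fun j => (j == i :> nat)%:R).
have [|_ /(_ (Ordinal im) (leqnn i))] := sub t; last first.
  by rewrite ct eqxx => /eqP; rewrite oner_eq0.
by split=> // j ij; rewrite ct gtn_eqF.
Qed.

(** In other words, [N] is a lower bound for the affine Hilbert function of [Z] at degree [d]. *)
Definition independent_polys (Z : set T) (d N : nat) : Prop :=
  exists F : 'I_N -> {mpoly k[m]}, (forall i, (msize (F i) <= d.+1)%N) /\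
    forall a : 'I_N -> k,
      (forall t, Z t -> \sum_i a i * (F i).@[c t] = 0) -> forall i, a i = 0.

Lemma independent_polys_le Z d d' N : (d <= d')%N ->
  independent_polys Z d N -> independent_polys Z d' N.
Proof.
move=> dd' [F [Fd Fi]]; exists F; split=> // i.
by apply: leq_trans (Fd i) _; rewrite ltnS.
Qed.

Lemma independent_polys1 Z d : Z !=set0 -> independent_polys Z d 1.
Proof.
move=> [t Zt]; exists (fun=> 1).
split=> [i|a /(_ t Zt)]; first by rewrite msize1.
by rewrite big_ord1 meval1 mulr1 => a0 i; rewrite ord1.
Qed.

(** In degree at most [d] all exponents are at most [d], which leaves (d + 1)^m monomials. With more
    polynomials than that, the coefficient matrix has a nonzero row vector in its left kernel. *)
Lemma independent_polys_bound Z d N : independent_polys Z d N ->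
  (N <= d.+1 ^ m)%N.
Proof.
move=> [F [Fd Fi]]; have cardE : #|{ffun 'I_m -> 'I_d.+1}| = (d.+1 ^ m)%N.
  by rewrite card_ffun !card_ord.
rewrite -cardE leqNgt; apply/negP => ltN.
pose M : 'M[k]_(N, #|{ffun 'I_m -> 'I_d.+1}|) :=
  \matrix_(i, j) (F i)@_[multinom
    nat_of_ord ((enum_val j : {ffun 'I_m -> 'I_d.+1}) l) | l < m].
have /rowV0Pn[u /sub_kermxP uM u0] : kermx M != 0.
  by rewrite kermx_eq0 /row_free neq_ltn (leq_ltn_trans (rank_leq_col M)).
have sumF0 : \sum_i u 0 i *: F i = 0.
  apply/mpolyP => a; rewrite mcoeff0 raddf_sum /=.
  under eq_bigr do rewrite mcoeffZ.
  have [lt_a|] := boolP [forall l, (a l < d.+1)%N]; last first.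
    rewrite negb_forall => /existsP[l]; rewrite -leqNgt => le_a.
    apply: big1 => i _.
    suff /memN_msupp_eq0-> : a \notin msupp (F i) by rewrite mulr0.
    apply/msize_mdeg_ge/(leq_trans (Fd i))/(leq_trans le_a).
    by rewrite mdegE (bigD1 l) //= leq_addr.
  pose f := [ffun l => inord (a l)] : {ffun 'I_m -> 'I_d.+1}.
  have aE : a = [multinom nat_of_ord (f l) | l < m].
    by apply/mnmP => l; rewrite mnmE ffunE inordK // (forallP lt_a).
  have /rowP/(_ (enum_rank f)) := uM; rewrite !mxE => uMf; rewrite -[RHS]uMf.
  by apply: eq_bigr => i _; rewrite mxE enum_rankK -aE.
case/eqP: u0; apply/rowP => i; rewrite mxE; apply: (Fi (u 0)) => t _.
transitivity (\sum_i u 0 i *: F i).@[c t]; last by rewrite sumF0 meval0.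
by rewrite (raddf_sum (meval (c t))); apply: eq_bigr => j _; rewrite /= mevalZ.
Qed.

(* If f vanishes on Y but not on the irreducible set Z, then f P, for P nonzero
   on Z, is still nonzero on Z, and it vanishes on Y. *)
Lemma independent_polysD (Y Z : set T) (f : {mpoly k[m]}) (e d N N' : nat) :
    Y `<=` Z -> irreducible_set Z -> (msize f <= e.+1)%N ->
    (forall t, Y t -> f.@[c t] = 0) -> (exists2 t, Z t & f.@[c t] != 0) ->
  independent_polys Y (d + e) N -> independent_polys Z d N' ->
  independent_polys Z (d + e) (N + N').
Proof.
move=> YZ [_ irrZ] f_e fY [t0 Zt0 ft0] [F [Fd Fi]] [G [Gd Gi]].
exists (fun i => match split i with inl i => F i | inr i => f * G i end).
split=> [i|a a0].
  case: split => j; first exact: Fd.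
  have [->|f0] := eqVneq f 0; first by rewrite mul0r msize0.
  have [->|G0] := eqVneq (G j) 0; first by rewrite mulr0 msize0.
  rewrite msizeM // -subn1 leq_subLR add1n (leq_trans (leq_add f_e (Gd j))) //.
  by rewrite addnS addSn addnC.
have aE t : \sum_(i < N) a (lshift N' i) * (F i).@[c t] +
    f.@[c t] * (\sum_(i < N') a (rshift N i) *: G i).@[c t] =
    \sum_i a i * (match split i with inl i => F i | inr i => f * G i end).@[c t].
  rewrite big_split_ord /=; congr (_ + _).
    by apply: eq_bigr => j _; rewrite -[lshift _ _]/(unsplit (inl j)) unsplitK.
  rewrite (raddf_sum (meval (c t))) mulr_sumr; apply: eq_bigr => j _ /=.
  by rewrite -[rshift _ _]/(unsplit (inr j)) unsplitK mevalZ mevalM mulrCA.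
have aF i : a (lshift N' i) = 0.
  apply: (Fi (fun i => a (lshift N' i))) => t Yt.
  by have := a0 t (YZ t Yt); rewrite -aE fY // mul0r addr0.
(* The product of [f] with the combination of the [G i] vanishes on [Z], so by irreducibility one of
   the two factors does. *)
have [|/(_ t0 Zt0) /eqP|aG] := irrZ _ _ (@closed_zeros f)
  (@closed_zeros (\sum_(i < N') a (rshift N i) *: G i)).
- move=> t /a0; rewrite -aE big1 => [|i _]; last by rewrite aF mul0r.
  by rewrite add0r => /eqP; rewrite mulf_eq0 => /orP[]/eqP; [left|right].
- by rewrite (negbTE ft0).
move=> i; rewrite -[i]splitK; case: (split i) => j; first exact: aF.
apply: (Gi (fun i => a (rshift N i))) => t /aG aGt.
rewrite -[RHS]aGt (raddf_sum (meval (c t))).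
by apply: eq_bigr => j' _; rewrite /= mevalZ.
Qed.

(** Pascal's rule, by induction on [t] inside the induction on [i]: C(t + 1 + i, i) functions
    independent on [Z i] are joined by [f] times C(t + i + 1, i + 1) functions independent on
    [Z i.+1]. *)
Lemma chain_independent_polys l Z : irreducible_chain A l Z ->
  forall i, (i <= l)%N -> exists E, forall t,
    independent_polys (Z i) (t * E) 'C(t + i, i).
Proof.
move=> [irrZ clZ ltZ]; elim=> [|i IHi] il.
  exists 0%N => t; rewrite bin0; apply: independent_polys1.
  by case: (irrZ 0%N il).
have [E ZE] := IHi (ltnW il).
have [sub /existsNP[r /not_implyP[Zr nZr]]] := ltZ i il.
have [C clC ZiE] := clZ i (ltnW il); have [C' _ Zi1E] := clZ i.+1 il.
have Ar : A r by move: Zr; rewrite Zi1E => -[].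
have [S SE] := closed_traceE clC.
have /existsNP[f /not_implyP[Sf /eqP fr]] : ~ forall P, S P -> P.@[c r] = 0.
  by move/(SE r Ar) => Cr; apply: nZr; rewrite ZiE.
have fZ t : Z i t -> f.@[c t] = 0.
  by rewrite ZiE => -[At /(SE t At)]; exact.
(* Each increase of [t] by one leaves room both for a multiplication by [f] and for the growth [E]
   of the degrees on [Z i]. *)
exists (E + msize f)%N; elim=> [|t IHt].
  by rewrite add0n binn; apply: independent_polys1; case: (irrZ _ il).
rewrite mulSnr addSn binS [('C(_, _) + _)%N]addnC.
apply: (@independent_polysD (Z i) (Z i.+1) f) => //.
- exact: irrZ.
- by rewrite leqW // leq_addl.
- by exists r.
- rewrite -addSnnS; apply: independent_polys_le (ZE t.+1).
  by rewrite -mulSnr leq_mul2l leq_addr orbT.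
Qed.

Lemma affine_krull_dim : has_krull_dim A m.
Proof.
split=> [|l Z chZ]; first by exists coord_subspace; exact: coord_subspace_chain.
have [E ZE] := chain_independent_polys chZ (leqnn l).
apply: (@bin_le_expn _ _ E) => t; exact/independent_polys_bound/ZE.
Qed.

End AffineDimension.

(** If a nonempty part of [A] is cut out both by an open [U] and by a closed [C], then [C] and the
    complement of [U] cover [A], and the latter cannot contain [A]. *)
Lemma irreducible_connected (T : topologicalType) (A : set T) :
  irreducible_set A -> connected A.
Proof.
move=> [_ irrA] B [b Bb] [U oU BU] [C clC BC].
have bA : A b by move: Bb; rewrite BC => -[].
have [|AC|AU] := irrA C (~` U)%classic clC (open_closedC oU).
- move=> t At; have [Ut|nUt] := pselect (U t); last by right.
  by left; have : B t by [rewrite BU; split]; rewrite BC => -[].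
- by rewrite BC; apply/setIidPl.
- by case: (AU b bA); move: Bb; rewrite BU => -[].
Qed.

(** * The group [Aut_der der] as an affine space, and its identity component *)

Section AutDerDimension.
Variables (m : nat) (k : closedFieldType).
Hypothesis char0 : [pchar k] =i pred0.
Local Notation der := (@der m k).
Local Notation offset := (@aut_offset m k).

Lemma aut_offset_closed (P : {mpoly k[m]}) :
  closed [set phi | P.@[offset phi] = 0]%classic.
Proof.
apply/closedE_ind => p.
have deg0 : (mdeg (0%MM : 'X_{1..m.+2}) < p.+1)%N by rewrite mdeg0.
(* The ambient coordinate that records the constant term of the image of [z i]. *)
pose j0 i : 'I_#|{: coord_ix m.+2 p}| := enum_rank (iz i, BMultinom deg0).
exists [set P \mPo [tuple 'X_(j0 i) | i < m]]%classic.
congr (_ `&` _)%classic; apply/seteqP.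
have PE phi : (P \mPo [tuple 'X_(j0 i) | i < m]).@[aut_coord (p := p) phi] =
    P.@[offset phi].
  rewrite comp_mpoly_meval; apply: meval_eq => i.
  by rewrite tnth_mktuple mevalXU /aut_coord enum_rankK.
by split=> phi /=; [move=> P0 _ -> | move/(_ _ erefl)]; rewrite PE.
Qed.

(** As the whole group lies in one piece of the filtration, the trace of a closed set on that piece
    determines its trace on the group. *)
Lemma Aut_der_deg_le : (Aut_der der `<=` @aut_deg_le m.+2 k 1)%classic.
Proof.
move=> phi phiD j; rewrite (aut_derX char0 j phiD).
rewrite (leq_trans (msizeD_le _ _)) // msizeX mdeg1 msizeC geq_max leqnn.
by rewrite leqW // leq_b1.
Qed.

Lemma aut_offset_trace (C : set (mpoly_aut m.+2 k)) : closed C ->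
  exists S : set {mpoly k[m]}, forall phi, Aut_der der phi ->
    C phi <-> forall P, S P -> P.@[offset phi] = 0.
Proof.
move=> /closedE_ind/(_ 1%N)[S CS].
pose zX := along_z (fun l => 'X_l : {mpoly k[m]}).
(* The ambient coordinate [a] of the generic translation, as a polynomial in the offsets;
   substituting it turns ambient equations into equations in the offsets. *)
pose q (a : coord_ix m.+2 1) : {mpoly k[m]} :=
  (('X_(a.1) : {mpoly k[m.+2]})@_(a.2))%:MP
  + (((a.2 : 'X_{1..m.+2}) == 0%MM)%:R)%:MP * zX a.1.
pose sub P := P \mPo [tuple q (enum_val j) | j < #|{: coord_ix m.+2 1}|].
have subE phi P : Aut_der der phi ->
    (sub P).@[offset phi] = P.@[aut_coord (p := 1) phi].
  move=> phiD; rewrite /sub comp_mpoly_meval; apply: meval_eq => j.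
  rewrite tnth_mktuple /aut_coord (aut_derX char0 _ phiD) /q.
  rewrite mcoeffD mcoeffC mevalD mevalM !mevalC mulrC; congr (_ + _ * _).
  by rewrite /zX /along_z; case: split => l; rewrite ?meval0 ?mevalXU.
exists [set sub P | P in S]%classic => phi phiD.
have phi1 := Aut_der_deg_le phiD.
have CE : C phi <-> aut_zeros S phi.
  have : (C `&` aut_deg_le 1)%classic phi <->
      (aut_zeros S `&` aut_deg_le 1)%classic phi.
    by rewrite CS.
  by case=> CS1 SC1; split=> h; [case: CS1|case: SC1].
split=> [/CE Sphi _ [P SP <-]|subS]; first by rewrite subE //; exact: Sphi.
by apply/CE => P SP; rewrite -subE //; apply: subS; exists P.
Qed.

Lemma aut_offset_onto v :
  exists2 phi, Aut_der der phi & offset phi =1 v.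
Proof.
by exists (translation (along_z v));
  [exact: translation_Aut_der|exact: aut_offset_translation].
Qed.

(** Being an affine space, the group is irreducible, hence connected. *)
Lemma Aut_der0E : Aut_der0 der = Aut_der der.
Proof.
apply: connected_component_id; first by [].
apply/irreducible_connected/affine_irreducible; last exact: aut_offset_onto.
exact: aut_offset_trace.
Qed.

Lemma Aut_der0_krull_dim : has_krull_dim (Aut_der0 der) m.
Proof.
rewrite Aut_der0E; apply: affine_krull_dim aut_offset_onto.
  exact: aut_offset_closed.
exact: aut_offset_trace.
Qed.

End AutDerDimension.

Theorem corollary4p13 (k : closedFieldType) (char0 : [pchar k] =i pred0)
    (n : nat) (n_ge2 : (2 <= n)%N) :
  exists D : {linear {mpoly k[n]} -> {mpoly k[n]}},
    [/\ is_derivation D, is_simple D & has_krull_dim (Aut_der0 D) (n - 2)%N].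
Proof.
case: n n_ge2 => [|[|m]] // _; exists (@der m k).
rewrite !subSS subn0; split; first exact: der_derivation.
  exact: der_simple.
exact: Aut_der0_krull_dim.
Qed.
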